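(* If $G$ is a smooth graph, then $G$ contains neither $K_{2,3}$ nor $K_{1,1,3}$ as an induced subgraph.
   Context: Graphs are simple and undirected; $d$ denotes the shortest path distance of a connected graph $G$. Intervals: $I[u,v]=\{w\in V(G): d(u,w)+d(w,v)=d(u,v)\}$; $N(u)=\{w: d(u,w)=1\}$; the step system (step function) of $G$ is $S(u,v)=I[u,v]\cap N(u)$. A connected graph $G$ is smooth if for all vertices $u,v,w,x,y$: $v\in S(u,w)$, $v\in S(u,y)$ and $x\in S(w,y)$ imply $v\in S(u,x)$. $K_{2,3}$ and $K_{1,1,3}$ are the complete multipartite graphs with parts of the indicated sizes. *)

(* Defs.v *)
From mathcomp Require Import all_boot.
From mathcomp Require Import boolp classical_sets.

Set Implicit Arguments.
Unset Strict Implicit.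
Unset Printing Implicit Defensive.

Local Open Scope classical_set_scope.

(* The vertex type is arbitrary: graphs may be infinite. *)
Record sgraph : Type := SGraph {
  vertex :> Type;
  adj : rel vertex;
  adj_sym : symmetric adj;
  adj_irrefl : irreflexive adj }.

Section Distance.
Variable G : sgraph.
Implicit Types u v w x y : G.

Definition walk u v (n : nat) : Prop :=
  exists p : seq G, [/\ path (@adj G) u p, last u p = v & size p = n].

Definition connected_graph : Prop := forall u v, exists n, walk u v n.

(* Total function; the value 0 for vertices in different components is a dummy
   that never occurs in a connected graph. *)
Definition dist u v : nat :=
  if pselect (exists n, `[< walk u v n >]) is left h then ex_minn h else 0.

Definition interval u v : set G := [set w | dist u w + dist w v = dist u v].

Definition nbhd u : set G := [set w | dist u w = 1].

Definition step u v : set G := interval u v `&` nbhd u.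

Definition smooth : Prop :=
  connected_graph /\
  forall u v w x y, step u w v -> step u y v -> step w y x -> step u x v.

End Distance.

Definition has_induced (G H : sgraph) : Prop :=
  exists f : H -> G, injective f /\ forall x y, adj (f x) (f y) = adj x y.

(* The complete multipartite graph whose i-th part has nth 0 s i vertices; a
   vertex is a pair (part, position in that part). *)
Section Multipartite.
Variable s : seq nat.

Definition multipartite_vertex : Type :=
  {i : 'I_(size s) & 'I_(nth 0 s i)}.

Definition multipartite_adj : rel multipartite_vertex :=
  fun x y => tag x != tag y.

Lemma multipartite_adj_sym : symmetric multipartite_adj.
Proof. by move=> x y; rewrite /multipartite_adj eq_sym. Qed.

Lemma multipartite_adj_irrefl : irreflexive multipartite_adj.
Proof. by move=> x; rewrite /multipartite_adj eqxx. Qed.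

Definition complete_multipartite : sgraph :=
  SGraph multipartite_adj_sym multipartite_adj_irrefl.

End Multipartite.

(* Main.v *)
Require Import Defs.
From mathcomp Require Import all_boot.
From mathcomp Require Import boolp.

(** Both graphs contain three pairwise non-adjacent vertices [c], [d], [e] with
    two distinct common neighbours [a] and [b]; they differ only in whether
    [a] and [b] are adjacent.  In an induced copy, [c], [d], [e] are at mutual
    distance 2, so [a] is a step from [c] towards both [d] and [e], while [b]
    is a step from [d] towards [e].  Smoothness makes [a] a step from [c]
    towards [b], that is, [1 + d(a,b) = d(c,b) = 1].  Hence [a = b], whether or
    not [a] and [b] are adjacent; this is [common_nbr_uniq], and it excludes
    both graphs at once. *)

Set Implicit Arguments.
Unset Strict Implicit.
Unset Printing Implicit Defensive.

Section ConnectedDistance.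
Variables (G : sgraph) (conG : connected_graph G).
Implicit Types u v w : G.

Lemma dist_walk u v : walk u v (dist u v).
Proof.
rewrite /dist; case: pselect => [h|[]].
  by case: ex_minnP => m /asboolP.
by have [n uvn] := conG u v; exists n; apply/asboolP.
Qed.

Lemma dist_le_walk u v n : walk u v n -> dist u v <= n.
Proof.
move=> uvn; rewrite /dist; case: pselect => [h|//].
by case: ex_minnP => m _; apply; apply/asboolP.
Qed.

Lemma dist_eq0 u v : dist u v = 0 -> u = v.
Proof. by have [p [_ <- <-]] := dist_walk u v => /size0nil ->. Qed.

Lemma dist_eq1_adj u v : dist u v = 1 -> adj u v.
Proof.
have [p [] + <- <-] := dist_walk u v.
by case: p => [|w []] //= /andP[].
Qed.

Lemma adj_dist u v : adj u v -> dist u v = 1.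
Proof.
move=> uv; have: dist u v <= 1.
  by apply: dist_le_walk; exists [:: v]; rewrite /= uv.
case E: (dist u v) => [|[]] // _.
by move: uv; rewrite (dist_eq0 E) adj_irrefl.
Qed.

Lemma dist_common_nbr u w v :
  u <> v -> ~~ adj u v -> adj u w -> adj w v -> dist u v = 2.
Proof.
move=> uDv Nuv uw wv; have: dist u v <= 2.
  by apply: dist_le_walk; exists [:: w; v]; rewrite /= uw wv.
case E: (dist u v) => [|[|[]]] // _.
  by case: uDv; apply: dist_eq0.
by rewrite dist_eq1_adj in Nuv.
Qed.

Lemma common_nbr_step u w v :
  u <> v -> ~~ adj u v -> adj u w -> adj w v -> step u v w.
Proof.
move=> uDv Nuv uw wv; split; rewrite /interval /nbhd /=; last exact: adj_dist.
by rewrite (dist_common_nbr uDv Nuv uw wv) !adj_dist.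
Qed.

Lemma step_to_nbr u v w : adj u v -> step u v w -> w = v.
Proof.
move=> uv [] /= + uw; rewrite /interval /nbhd /= in uw *.
by rewrite uw (adj_dist uv) => -[] /dist_eq0.
Qed.

End ConnectedDistance.

(** The smoothness axiom at [u := c], [v := a], [w := d], [y := e], [x := b]
    gives a step [a] from [c] towards its neighbour [b]. *)
Lemma common_nbr_uniq (G : sgraph) (a b c d e : G) : smooth G ->
  c <> d -> c <> e -> d <> e ->
  ~~ adj c d -> ~~ adj c e -> ~~ adj d e ->
  adj a c -> adj a d -> adj a e -> adj b c -> adj b d -> adj b e ->
  a = b.
Proof.
move=> [conG smG] cDd cDe dDe Ncd Nce Nde ac ad ae bc bd be.
apply: (step_to_nbr conG (u := c)); first by rewrite adj_sym.
by apply: (smG c a d b e); apply: common_nbr_step; rewrite // adj_sym.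
Qed.

Lemma smooth_no_induced (G H : sgraph) (a b c d e : H) : smooth G ->
  a <> b -> c <> d -> c <> e -> d <> e ->
  ~~ adj c d -> ~~ adj c e -> ~~ adj d e ->
  adj a c -> adj a d -> adj a e -> adj b c -> adj b d -> adj b e ->
  ~ has_induced G H.
Proof.
move=> smG aDb cDd cDe dDe Ncd Nce Nde ac ad ae bc bd be [f [f_inj f_adj]].
apply/aDb/f_inj.
by apply: (@common_nbr_uniq G _ _ (f c) (f d) (f e)); rewrite ?f_adj // => /f_inj.
Qed.

(** Building the vertex from naturals lets every distinctness and adjacency
    condition below be decided by computation. *)
Definition mvertex (s : seq nat) (i j : nat) (lt_i : i < size s)
    (lt_j : j < nth 0 s i) : complete_multipartite s :=
  existT (fun k : 'I_(size s) => 'I_(nth 0 s k)) (Ordinal lt_i) (Ordinal lt_j).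

Theorem mainTheorem7 (G : sgraph) (hG : smooth G) :
  ~ has_induced G (complete_multipartite [:: 2; 3]) /\
  ~ has_induced G (complete_multipartite [:: 1; 1; 3]).
Proof.
split.
- pose v i j := @mvertex [:: 2; 3] i j.
  by apply: (smooth_no_induced (a := v 0 0 isT isT) (b := v 0 1 isT isT)
    (c := v 1 0 isT isT) (d := v 1 1 isT isT) (e := v 1 2 isT isT)) => //;
    move/eqP.
- pose v i j := @mvertex [:: 1; 1; 3] i j.
  by apply: (smooth_no_induced (a := v 0 0 isT isT) (b := v 1 0 isT isT)
    (c := v 2 0 isT isT) (d := v 2 1 isT isT) (e := v 2 2 isT isT)) => //;
    move/eqP.
Qed.
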